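(* Let $\Sigma$ be a many-sorted signature, $\mathcal{T}$ a $\Sigma$-theory and $S$ a non-empty set of sorts of $\Sigma$. If $\mathcal{T}$ is stably infinite with respect to $S$, stably finite with respect to $S$, and has a computable minimal model function with respect to $S$, then $\mathcal{T}$ is decidable.
   Context: Many-sorted first-order logic with equality. A signature $\Sigma$ consists of a non-empty set of sorts, function symbols with arities $\sigma_1\times\cdots\times\sigma_n\to\sigma$, and predicate symbols with arities $\sigma_1\times\cdots\times\sigma_n$, including an equality symbol for each sort. A $\Sigma$-interpretation is a $\Sigma$-structure (assigning a non-empty domain $\sigma^{\mathcal{A}}$ to each sort $\sigma$) together with an assignment of elements of the appropriate domains to variables. A $\Sigma$-theory $\mathcal{T}$ is the class of all $\Sigma$-interpretations satisfying a given set of $\Sigma$-sentences (its axiomatization); its members are called $\mathcal{T}$-interpretations. A formula is $\mathcal{T}$-satisfiable if some $\mathcal{T}$-interpretation satisfies it. $\mathcal{T}$ is decidable if the set of $\mathcal{T}$-satisfiable quantifier-free $\Sigma$-formulas is decidable. For a set $S$ of sorts: $\mathcal{T}$ is stably infinite w.r.t. $S$ if every $\mathcal{T}$-satisfiable quantifier-free formula is satisfied by a $\mathcal{T}$-interpretation $\mathcal{A}$ with $\sigma^{\mathcal{A}}$ infinite for all $\sigma\in S$. $\mathcal{T}$ is stably finite w.r.t. $S$ if for every quantifier-free $\varphi$ and $\mathcal{T}$-interpretation $\mathcal{A}\models\varphi$ there is a $\mathcal{T}$-interpretation $\mathcal{B}\models\varphi$ with $\sigma^{\mathcal{B}}$ finite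 and $|\sigma^{\mathcal{B}}|\le|\sigma^{\mathcal{A}}|$ for all $\sigma\in S$. A minimal model function w.r.t. $S$ is a function $\mathsf{MM}$ defined on all quantifier-free $\Sigma$-formulas, returning a set $\mathsf{MM}(\varphi)$ of functions $\mathbf{n}$ from $S$ to cardinals, such that whenever $\varphi$ is $\mathcal{T}$-satisfiable: (i) for each $\mathbf{n}\in\mathsf{MM}(\varphi)$ there is a $\mathcal{T}$-interpretation $\mathcal{A}\models\varphi$ with $|\sigma^{\mathcal{A}}|=\mathbf{n}(\sigma)$ for all $\sigma\in S$; (ii) if $\mathbf{m}\ne\mathbf{n}$ are in $\mathsf{MM}(\varphi)$ then $\mathbf{m}(\sigma)<\mathbf{n}(\sigma)$ for some $\sigma\in S$; (iii) for every $\mathcal{T}$-interpretation $\mathcal{A}\models\varphi$ there is $\mathbf{n}\in\mathsf{MM}(\varphi)$ with $\mathbf{n}(\sigma)\le|\sigma^{\mathcal{A}}|$ for all $\sigma\in S$. No condition is imposed on $\mathsf{MM}(\varphi)$ when $\varphi$ is not $\mathcal{T}$-satisfiable; the function must be total and computable. *)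

(* Defs.v *)
From mathcomp Require Import all_boot.
From mathcomp Require Import boolp classical_sets functions cardinality.

Set Implicit Arguments.
Unset Strict Implicit.
Unset Printing Implicit Defensive.

Local Open Scope classical_set_scope.
Local Open Scope card_scope.

(* Kleene's partial recursive functions: [recfun n] is the syntax of n-ary
   definitions, and [rec_eval f v y] means that f converges on v to y. *)
Inductive recfun : nat -> Type :=
| RZero n : recfun n
| RSucc : recfun 1
| RProj n (i : 'I_n) : recfun n
| RComp m n (f : recfun m) (g : 'I_m -> recfun n) : recfun n
| RPrec n (f : recfun n) (g : recfun n.+2) : recfun n.+1
| RMu n (f : recfun n.+1) : recfun n.

Fixpoint rec_eval n (f : recfun n) {struct f} : n.-tuple nat -> nat -> Prop :=
  match f in recfun n return n.-tuple nat -> nat -> Prop with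
  | RZero _ => fun _ y => y = 0
  | RSucc => fun v y => y = (thead v).+1
  | RProj _ i => fun v y => y = tnth v i
  | RComp m _ f g => fun v y =>
      exists2 w : m.-tuple nat,
        forall i, rec_eval (g i) v (tnth w i) & rec_eval f w y
  | RPrec _ f g => fun v y =>
      exists h : nat -> nat,
        [/\ rec_eval f [tuple of behead v] (h 0),
            forall k, k < thead v ->
              rec_eval g [tuple of k :: h k :: behead v] (h k.+1)
          & y = h (thead v)]
  | RMu _ f => fun v y =>
      rec_eval f [tuple of y :: v] 0 /\
      forall k, k < y -> exists z, rec_eval f [tuple of k :: v] z.+1
  end.

(* The countType structures fix the numbering ([pickle]) of the symbols that is
   used to present formulas to algorithms.  Equality at each sort is a logical
   symbol (constructor [FEq] below), hence not listed in [psym]. *)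
Record signature := Signature {
  sorts : countType;
  sorts_inhabited : inhabited sorts;
  fsym : countType;
  fdom : fsym -> seq sorts;
  fcod : fsym -> sorts;
  psym : countType;
  pdom : psym -> seq sorts
}.

Fixpoint sprod (I : Type) (D : I -> Type) (ss : seq I) : Type :=
  if ss is s :: ss' then (D s * sprod D ss')%type else unit.

Section Logic.
Variable Sg : signature.

(* The variable (s, x) is the x-th variable of sort s. *)
Definition var : Type := (sorts Sg * nat)%type.

Inductive term : sorts Sg -> Type :=
| Var (x : var) : term x.1
| App (f : fsym Sg) (ts : terms (fdom f)) : term (fcod f)
with terms : seq (sorts Sg) -> Type :=
| TNil : terms [::]
| TCons s ss (t : term s) (ts : terms ss) : terms (s :: ss).

Inductive formula : Type :=
| FEq s (t u : term s)
| FPred (p : psym Sg) (ts : terms (pdom p))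
| FNot (a : formula)
| FAnd (a b : formula)
| FOr (a b : formula)
| FImp (a b : formula)
| FForall (x : var) (a : formula)
| FExists (x : var) (a : formula).

Fixpoint qfree (a : formula) : bool :=
  match a with
  | FEq _ _ _ | FPred _ _ => true
  | FNot a => qfree a
  | FAnd a b | FOr a b | FImp a b => qfree a && qfree b
  | FForall _ _ | FExists _ _ => false
  end.

Fixpoint term_vars s (t : term s) : seq var :=
  match t with
  | Var x => [:: x]
  | App _ ts => terms_vars ts
  end
with terms_vars ss (ts : terms ss) : seq var :=
  match ts with
  | TNil => [::]
  | TCons _ _ t ts => term_vars t ++ terms_vars ts
  end.

Fixpoint free_vars (a : formula) : seq var :=
  match a with
  | FEq _ t u => term_vars t ++ term_vars u
  | FPred _ ts => terms_vars ts
  | FNot a => free_vars a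
  | FAnd a b | FOr a b | FImp a b => free_vars a ++ free_vars b
  | FForall x a | FExists x a => [seq y <- free_vars a | y != x]
  end.

Definition sentence (a : formula) : Prop := free_vars a = [::].

Record structure := Structure {
  carrier :> sorts Sg -> Type;
  carrier_inhabited : forall s, inhabited (carrier s);
  fint : forall f : fsym Sg, sprod carrier (fdom f) -> carrier (fcod f);
  pint : forall p : psym Sg, sprod carrier (pdom p) -> Prop
}.

Definition assignment (M : structure) := forall x : var, M x.1.

Fixpoint teval (M : structure) (e : assignment M) s (t : term s) : M s :=
  match t in term s return M s with
  | Var x => e x
  | App f ts => fint (tseval e ts)
  end
with tseval (M : structure) (e : assignment M) ss (ts : terms ss)
    : sprod M ss :=
  match ts in terms ss return sprod M ss with
  | TNil => tt
  | TCons _ _ t ts => (teval e t, tseval e ts)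
  end.

Fixpoint sat (M : structure) (e : assignment M) (a : formula) : Prop :=
  match a with
  | FEq _ t u => teval e t = teval e u
  | FPred _ ts => pint (tseval e ts)
  | FNot a => ~ sat e a
  | FAnd a b => sat e a /\ sat e b
  | FOr a b => sat e a \/ sat e b
  | FImp a b => sat e a -> sat e b
  | FForall x a => forall d : M x.1, sat (dfwith e d) a
  | FExists x a => exists d : M x.1, sat (dfwith e d) a
  end.

Record interpretation := Interpretation {
  structure_of :> structure;
  assignment_of : assignment structure_of
}.

Definition models (A : interpretation) (a : formula) : Prop :=
  sat (assignment_of A) a.

(* A theory is given by its axiomatization; the class of interpretations that
   it denotes is [interp_of]. *)
Record theory := Theory {
  axioms : set formula;
  axioms_sentences : forall a, axioms a -> sentence a
}.

Definition interp_of (T : theory) (A : interpretation) : Prop :=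
  forall a, axioms T a -> models A a.

Definition satisfiable (T : theory) (a : formula) : Prop :=
  exists2 A, interp_of T A & models A a.

(* Goedel numbers; [CodeSeq.code] is a primitive recursive bijection from
   [seq nat] to [nat]. *)
Fixpoint term_code s (t : term s) : nat :=
  match t with
  | Var x => CodeSeq.code [:: 0; pickle x.1; x.2]
  | App f ts => CodeSeq.code [:: 1, pickle f & terms_codes ts]
  end
with terms_codes ss (ts : terms ss) : seq nat :=
  match ts with
  | TNil => [::]
  | TCons _ _ t ts => term_code t :: terms_codes ts
  end.

Fixpoint formula_code (a : formula) : nat :=
  match a with
  | FEq s t u => CodeSeq.code [:: 0; pickle s; term_code t; term_code u]
  | FPred p ts => CodeSeq.code [:: 1, pickle p & terms_codes ts]
  | FNot a => CodeSeq.code [:: 2; formula_code a]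
  | FAnd a b => CodeSeq.code [:: 3; formula_code a; formula_code b]
  | FOr a b => CodeSeq.code [:: 4; formula_code a; formula_code b]
  | FImp a b => CodeSeq.code [:: 5; formula_code a; formula_code b]
  | FForall x a => CodeSeq.code [:: 6; pickle x.1; x.2; formula_code a]
  | FExists x a => CodeSeq.code [:: 7; pickle x.1; x.2; formula_code a]
  end.

(* Algorithms take (codes of) quantifier-free formulas as inputs; nothing is
   required on numbers that are not such codes.  When the set of these codes is
   itself decidable this is decidability of a set of numbers. *)
Definition decidable_theory (T : theory) : Prop :=
  exists f : recfun 1, forall a, qfree a ->
    (satisfiable T a -> rec_eval f [tuple formula_code a] 1) /\
    (~ satisfiable T a -> rec_eval f [tuple formula_code a] 0).

Section SortSet.
Variables (T : theory) (S : set (sorts Sg)).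

Definition stably_infinite : Prop :=
  forall a, qfree a -> satisfiable T a ->
    exists A, [/\ interp_of T A, models A a
                & forall s, S s -> infinite_set [set: A s]].

Definition stably_finite : Prop :=
  forall a, qfree a -> forall A, interp_of T A -> models A a ->
    exists B, [/\ interp_of T B, models B a
                & forall s, S s ->
                    finite_set [set: B s] /\ ([set: B s] #<= [set: A s])].

(* A cardinal is represented by any type of that cardinality, so that two
   functions from S to cardinals are the same when they are pointwise
   equipotent. *)
Definition cardfun : Type := S -> Type.

Definition cardfun_eq (m n : cardfun) : Prop :=
  forall s : S, [set: m s] #= [set: n s].

Definition minimal_model_function (MM : formula -> set cardfun) : Prop :=
  forall a, qfree a -> satisfiable T a ->
    [/\ forall n, MM a n ->
          exists A, [/\ interp_of T A, models A a
                      & forall s : S, [set: A (val s)] #= [set: n s]],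
        forall m n, MM a m -> MM a n -> ~ cardfun_eq m n ->
          exists s : S, ([set: m s] #<= [set: n s]) /\
                        ~ ([set: m s] #= [set: n s])
      & forall A, interp_of T A -> models A a ->
          exists2 n, MM a n & forall s : S, [set: n s] #<= [set: A (val s)]].

(* Names for the cardinals that an algorithm can output: k.+1 stands for the
   finite cardinal k, and 0 stands for aleph_0. *)
Definition named_cardinal (c : nat) : set nat :=
  if c is k.+1 then `I_k else setT.

(* The value at a formula is computed as a finite list of functions from S to
   {0, 1, 2, ...; aleph_0}: [len] computes the length of the list from the
   formula, and [entry] the name of the value at a sort s of S of the i-th
   function of the list.  For finite S, this is the same as computing a finite
   list of tuples of names of cardinals. *)
Definition computable_cardfuns (MM : formula -> set cardfun) : Prop :=
  exists (len : recfun 1) (entry : recfun 3),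
  forall a, qfree a -> exists (l : nat) (c : nat -> S -> nat),
    [/\ rec_eval len [tuple formula_code a] l,
        forall i, i < l -> forall s : S,
          rec_eval entry [tuple formula_code a; i; pickle (val s)] (c i s)
      & forall n, MM a n <->
          exists2 i, i < l &
            forall s : S, [set: n s] #= named_cardinal (c i s)].

End SortSet.
End Logic.

(* Main.v *)
Require Import Defs.
From mathcomp Require Import all_boot.
From mathcomp Require Import boolp classical_sets functions cardinality.

(* Fix a sort s in S and let delta_K say that K variables of sort s are pairwise
   distinct.  If phi is satisfiable, stable finiteness forces every member n of
   MM(phi) to be finite on S, and then phi has a model whose s-domain has
   k = n(s) elements.  Put K = k + 1 and compute MM(delta_K \/ phi).  Unless T
   is inconsistent, delta_K \/ phi is satisfiable by stable infiniteness,
   whether or not phi is, so MM is meaningful at this formula.  If phi is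
   unsatisfiable, all models of delta_K \/ phi have at least K elements of sort
   s; if phi is satisfiable, some member of MM(delta_K \/ phi) is at most k at s.
   So phi is satisfiable iff MM(delta_K \/ phi) has a member less than K at s. *)

Set Implicit Arguments.
Unset Strict Implicit.
Unset Printing Implicit Defensive.

Local Open Scope classical_set_scope.
Local Open Scope card_scope.

(** * Recursive functions *)

(** The clause for [RPrec] asks for the whole course of values [h], so each use supplies the closed
    form of the computed function and checks only base and step. *)
Lemma eval_prec n (f : recfun n) g (h : nat -> nat) k (v : n.-tuple nat) :
  rec_eval f v (h 0) ->
  (forall i, i < k -> rec_eval g [tuple of i :: h i :: v] (h i.+1)) ->
  rec_eval (RPrec f g) [tuple of k :: v] (h k).
Proof.
move=> f0 gS /=.
have -> : [tuple of behead (k :: v)] = v by exact: val_inj.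
have E i : [tuple of i :: h i :: behead (k :: v)] = [tuple of i :: h i :: v].
  exact: val_inj.
by exists h; split=> // i ik; rewrite E; apply: gS.
Qed.

Arguments rec_eval : simpl never.

Definition rproj n i (lt_in : i < n) : recfun n := RProj (Ordinal lt_in).

Definition rcomp1 n (f : recfun 1) (g : recfun n) : recfun n :=
  RComp f (tnth [tuple g]).

Definition rcomp2 n (f : recfun 2) (g1 g2 : recfun n) : recfun n :=
  RComp f (tnth [tuple g1; g2]).

Definition rcomp3 n (f : recfun 3) (g1 g2 g3 : recfun n) : recfun n :=
  RComp f (tnth [tuple g1; g2; g3]).

Lemma eval_comp1 n f (g : recfun n) v a y :
  rec_eval g v a -> rec_eval f [tuple a] y -> rec_eval (rcomp1 f g) v y.
Proof. by move=> ga fy; exists [tuple a] => // -[[|i] //= lt_i]. Qed.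

Lemma eval_comp2 n f (g1 g2 : recfun n) v a1 a2 y :
  rec_eval g1 v a1 -> rec_eval g2 v a2 -> rec_eval f [tuple a1; a2] y ->
  rec_eval (rcomp2 f g1 g2) v y.
Proof.
by move=> ga1 ga2 fy; exists [tuple a1; a2] => // -[[|[|i]] //= lt_i].
Qed.

Lemma eval_comp3 n f (g1 g2 g3 : recfun n) v a1 a2 a3 y :
  rec_eval g1 v a1 -> rec_eval g2 v a2 -> rec_eval g3 v a3 ->
  rec_eval f [tuple a1; a2; a3] y ->
  rec_eval (rcomp3 f g1 g2 g3) v y.
Proof.
move=> ga1 ga2 ga3 fy.
by exists [tuple a1; a2; a3] => // -[[|[|[|i]]] //= lt_i].
Qed.

Fixpoint rconst n k : recfun n :=
  if k is k'.+1 then rcomp1 RSucc (rconst n k') else RZero n.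

Lemma eval_const n k v : rec_eval (rconst n k) v k.
Proof. by elim: k => [|k IHk]; [| apply: eval_comp1 IHk _]. Qed.

Definition rdouble : recfun 1 :=
  RPrec (RZero 0) (rcomp1 RSucc (rcomp1 RSucc (@rproj 2 1 isT))).

Lemma eval_double m : rec_eval rdouble [tuple m] m.*2.
Proof.
apply: (@eval_prec 0 _ _ double) => // i _.
by apply: eval_comp1; [apply: eval_comp1; exact: erefl | exact: erefl].
Qed.

(** [CodeSeq.code (a :: l)] is [2 ^ a] times the odd number [(CodeSeq.code l).*2.+1]: start from the
    odd factor and double it [a] times. *)
Definition rcode_cons : recfun 2 :=
  RPrec (rcomp1 RSucc rdouble) (rcomp1 rdouble (@rproj 3 1 isT)).

Lemma eval_code_cons a l :
  rec_eval rcode_cons [tuple a; CodeSeq.code l] (CodeSeq.code (a :: l)).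
Proof.
apply: (@eval_prec 1 _ _ (fun a => CodeSeq.code (a :: l))) => [|i _].
  by apply: eval_comp1 (eval_double _) _; rewrite /= mul1n.
apply: eval_comp1; first exact: erefl.
by rewrite [CodeSeq.code (i.+1 :: l)]/= expnS -mulnA mul2n; exact: eval_double.
Qed.

Definition rcode n (gs : seq (recfun n)) : recfun n :=
  foldr (rcomp2 rcode_cons) (RZero n) gs.

Lemma eval_code_nil n v : rec_eval (@rcode n [::]) v (CodeSeq.code [::]).
Proof. by []. Qed.

Lemma eval_code n (g : recfun n) gs v a l :
  rec_eval g v a -> rec_eval (rcode gs) v (CodeSeq.code l) ->
  rec_eval (rcode (g :: gs)) v (CodeSeq.code (a :: l)).
Proof. by move=> ga gsl; apply: eval_comp2 ga gsl (eval_code_cons _ _). Qed.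

Definition rpred : recfun 1 := RPrec (RZero 0) (@rproj 2 0 isT).

Lemma eval_pred m : rec_eval rpred [tuple m] m.-1.
Proof. by apply: (@eval_prec 0 _ _ predn). Qed.

(** Recursion runs on the first argument, so that is the one subtracted. *)
Definition rsub : recfun 2 :=
  RPrec (@rproj 1 0 isT) (rcomp1 rpred (@rproj 3 1 isT)).

Lemma eval_sub m n : rec_eval rsub [tuple m; n] (n - m).
Proof.
apply: (@eval_prec 1 _ _ (subn n)) => [|i _]; first by rewrite /= subn0.
by apply: eval_comp1; [exact: erefl | rewrite subnS; exact: eval_pred].
Qed.

Definition rpos_or : recfun 2 := RPrec (@rproj 1 0 isT) (rconst 3 1).

Lemma eval_pos_or z (b : bool) :
  rec_eval rpos_or [tuple z; nat_of_bool b] ((0 < z) || b).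
Proof.
apply: (@eval_prec 1 _ _ (fun z => nat_of_bool ((0 < z) || b))) => // i _.
exact: eval_const.
Qed.

(** Recursion on [e] acts as a case distinction, with [i < K] tested as [0 < K - i]. For a name [e],
    the test [0 < e <= K] says that the named cardinal is finite and less than [K]. *)
Definition rrange_or : recfun 3 :=
  RPrec (@rproj 2 1 isT)
    (rcomp2 rpos_or (rcomp2 rsub (@rproj 4 0 isT) (@rproj 4 2 isT))
                    (@rproj 4 3 isT)).

Lemma eval_range_or e K (b : bool) :
  rec_eval rrange_or [tuple e; K; nat_of_bool b] ((0 < e <= K) || b).
Proof.
apply: (@eval_prec 2 _ _ (fun e => nat_of_bool ((0 < e <= K) || b))) => // i _.
apply: (@eval_comp2 _ _ _ _ _ (K - i) b) => //.
  by apply: eval_comp2; [exact: erefl | exact: erefl | exact: eval_sub].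
by rewrite -(subn_gt0 i); exact: eval_pos_or.
Qed.

(** * Interpretations *)

Scheme term_mind := Induction for term Sort Prop
  with terms_mind := Induction for terms Sort Prop.
Combined Scheme term_terms_ind from term_mind, terms_mind.

Section Coincidence.
Variables (Sg : signature) (M : structure Sg).
Implicit Types e : assignment M.

Lemma teval_tseval_eq e e' :
  (forall s (t : term s),
     {in term_vars t, forall x, e x = e' x} -> teval e t = teval e' t) /\
  (forall ss (ts : terms ss),
     {in terms_vars ts, forall x, e x = e' x} -> tseval e ts = tseval e' ts).
Proof.
apply: term_terms_ind => [x|f ts IH|//|s ss t IHt ts IHts] E /=.
- by apply: E; rewrite /= mem_head.
- by rewrite IH.
- by rewrite IHt ?IHts // => x xt; apply: E; rewrite /= mem_cat xt ?orbT.
Qed.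

Lemma sat_eq e e' a :
  {in free_vars a, forall x, e x = e' x} -> sat e a <-> sat e' a.
Proof.
have catE (A B : seq (var Sg)) (f f' : assignment M) :
    {in A ++ B, forall x, f x = f' x} ->
    {in A, forall x, f x = f' x} /\ {in B, forall x, f x = f' x}.
  by move=> E; split=> x xA; apply: E; rewrite mem_cat xA ?orbT.
have dfE A x (f f' : assignment M) (d : M x.1) :
    {in [seq y <- A | y != x], forall y, f y = f' y} ->
    {in A, forall y, dfwith f d y = dfwith f' d y}.
  move=> E y yA; have [<-|xy] := eqVneq x y; first by rewrite !dfwith_in.
  by rewrite !dfwith_out //; apply: E; rewrite mem_filter eq_sym xy.
elim: a e e' => [s t u|p ts|a IH|a IHa b IHb|a IHa b IHb|a IHa b IHb
  |x a IH|x a IH] e e' /= E.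
- have [teq _] := teval_tseval_eq e e'.
  by case/catE: E => /teq -> /teq ->.
- by rewrite (proj2 (teval_tseval_eq e e') _ _ E).
- by rewrite (IH _ _ E).
- by case/catE: E => /IHa -> /IHb ->.
- by case/catE: E => /IHa -> /IHb ->.
- by case/catE: E => /IHa -> /IHb ->.
- by split=> H d; apply/(IH _ _ (dfE _ _ _ _ _ E)).
- by split=> -[d H]; exists d; apply/(IH _ _ (dfE _ _ _ _ _ E)).
Qed.

(** Axioms have no free variables, so variables may be reassigned freely inside a model of [T]. *)
Lemma interp_of_assignment (T : theory Sg) e e' :
  interp_of T (Interpretation e) -> interp_of T (Interpretation e').
Proof.
move=> Te a Ta; apply/(sat_eq (e := e)); last exact: Te.
by rewrite (axioms_sentences Ta).
Qed.

End Coincidence.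

(** * Distinctness formulas *)

Section Distinct.
Variables (Sg : signature) (s : sorts Sg).

Definition eq_vars i j : formula Sg := @FEq Sg s (Var (s, i)) (Var (s, j)).

(** The syntax has no constant for truth; [eq_vars n n] stands in for the empty conjunction. *)
Fixpoint new_var n j : formula Sg :=
  if j is j'.+1 then FAnd (FNot (eq_vars n j')) (new_var n j')
  else eq_vars n n.

Fixpoint distinct n : formula Sg :=
  if n is n'.+1 then FAnd (new_var n' n') (distinct n') else eq_vars 0 0.

Lemma qfree_distinct n : qfree (distinct n).
Proof.
have new_varP j m : qfree (new_var m j) by elim: j.
by elim: n => //= n ->; rewrite new_varP.
Qed.

Lemma sat_distinct (M : structure Sg) (e : assignment M) n :
  sat e (distinct n) <-> {in `I_n &, injective (fun i => e (s, i) : M s)}.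
Proof.
have sat_new m j :
    sat e (new_var m j) <-> forall i, i < j -> e (s, m) <> e (s, i).
  elim: j => //= j ->; split=> [[ne_j ne] i|ne]; last first.
    by split=> [|i ij]; apply: ne => //; exact: ltnW.
  by rewrite ltnS leq_eqVlt => /predU1P[-> //|]; exact: ne.
elim: n => [|n /= ->].
  by split=> // _ i; rewrite inE.
rewrite sat_new; split=> [[ne inj] i j|inj].
  rewrite !inE /= !ltnS (leq_eqVlt i) (leq_eqVlt j).
  case/predU1P=> [->|lt_in] /predU1P[-> //|lt_jn] E.
  - by case: (ne _ lt_jn).
  - by case: (ne _ lt_in).
  - by apply: inj; rewrite ?inE.
split=> [i lt_in E|i j].
  by move: (lt_in); rewrite -(inj n i _ _ E) ?ltnn // !inE /= ltnS // ltnW.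
by rewrite !inE => ? ?; apply: inj; rewrite inE /= ltnW.
Qed.

Lemma sat_distinct_card (M : structure Sg) (e : assignment M) n :
  sat e (distinct n) -> `I_n #<= [set: M s].
Proof.
move=> /sat_distinct/inj_card_eq/card_esym/card_le_eql ->.
exact: subset_card_le.
Qed.

(** An injective sequence in the domain, used as the values of the variables of sort [s], works for
    all [n] at once. *)
Lemma infinite_sat_distinct (M : structure Sg) :
  infinite_set [set: M s] ->
  exists e : assignment M, forall n, sat e (distinct n).
Proof.
move=> /infiniteP/card_leP[f].
pose g i : M s := \val (f (to_setT i)).
have g_inj : injective g.
  by move=> i j /val_inj/(@inj _ _ _ f _ _ (in_setT _) (in_setT _))/(congr1 val).
(* Variables of the other sorts get an arbitrary element of their non-empty domain. *)
have inh s' : exists _ : M s', True.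
  by case: (carrier_inhabited M s') => d; exists d.
pose h s' (_ : nat) : M s' := projT1 (cid (inh s')).
exists (fun x => dfwith h g x.1 x.2) => n.
by apply/sat_distinct => i j _ _; rewrite dfwith_in; exact: g_inj.
Qed.

Definition req_vars n (g h : recfun n) : recfun n :=
  let var g := rcode [:: RZero n; rconst n (pickle s); g] in
  rcode [:: RZero n; rconst n (pickle s); var g; var h].

Lemma eval_eq_vars n (g h : recfun n) v i j :
  rec_eval g v i -> rec_eval h v j ->
  rec_eval (req_vars g h) v (formula_code (eq_vars i j)).
Proof.
move=> gi hj; have c0 : rec_eval (RZero n) v 0 by [].
by do !apply: eval_code => //; exact: eval_const.
Qed.

(** The tags 3 and 2 are those of [FAnd] and [FNot]; [h] is the code of the shorter conjunction. *)
Definition rnew_var : recfun 2 :=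
  let k := @rproj 3 0 isT in let h := @rproj 3 1 isT in
  let n := @rproj 3 2 isT in
  RPrec (req_vars (@rproj 1 0 isT) (@rproj 1 0 isT))
    (rcode [:: rconst 3 3; rcode [:: rconst 3 2; req_vars n k]; h]).

Lemma eval_new_var j n :
  rec_eval rnew_var [tuple j; n] (formula_code (new_var n j)).
Proof.
apply: (@eval_prec 1 _ _ (fun j => formula_code (new_var n j))) => [|i _].
  by apply: eval_eq_vars.
by do !apply: eval_code => //; exact: eval_const.
Qed.

Definition rdistinct : recfun 1 :=
  let k := @rproj 2 0 isT in let h := @rproj 2 1 isT in
  RPrec (req_vars (RZero 0) (RZero 0))
    (rcode [:: rconst 2 3; rcomp2 rnew_var k k; h]).

Lemma eval_distinct n :
  rec_eval rdistinct [tuple n] (formula_code (distinct n)).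
Proof.
apply: (@eval_prec 0 _ _ (fun n => formula_code (distinct n))) => [|i _].
  by apply: eval_eq_vars.
do !apply: eval_code => //; first exact: eval_const.
by apply: eval_comp2; [exact: erefl | exact: erefl | exact: eval_new_var].
Qed.

End Distinct.

(** * The decision procedure *)

Section Decision.
Variables (len : recfun 1) (entry : recfun 3) (p : nat).

(** This computes [K]. Any member of the list would do; a recursion that discards its previous value
    yields the last one. No successor is taken, since the name of the cardinal [k] is already
    [k.+1]. *)
Definition rlast_entry : recfun 1 :=
  rcomp2 (RPrec (RZero 1)
            (rcomp3 entry (@rproj 3 2 isT) (@rproj 3 0 isT) (rconst 3 p)))
         len (@rproj 1 0 isT).

Lemma eval_last_entry x l c :
  rec_eval len [tuple x] l ->
  (forall i, i < l -> rec_eval entry [tuple x; i; p] (c i)) ->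
  rec_eval rlast_entry [tuple x] (if l is k.+1 then c k else 0).
Proof.
move=> lenx entryx; apply: eval_comp2; [exact: lenx | exact: erefl |].
apply: (@eval_prec 1 _ _ (fun l => if l is k.+1 then c k else 0)) => // i il.
apply: eval_comp3; [exact: erefl | exact: erefl | exact: eval_const |].
exact: entryx.
Qed.

(** Bounded search: the recursion accumulates the disjunction of the tests on the entries seen so
    far. *)
Definition rhas_entry : recfun 3 :=
  RPrec (RZero 2)
    (rcomp3 rrange_or
       (rcomp3 entry (@rproj 4 2 isT) (@rproj 4 0 isT) (rconst 4 p))
       (@rproj 4 3 isT) (@rproj 4 1 isT)).

Lemma eval_has_entry x K l c :
  (forall i, i < l -> rec_eval entry [tuple x; i; p] (c i)) ->
  rec_eval rhas_entry [tuple l; x; K]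
    (has (fun i => 0 < c i <= K) (iota 0 l)).
Proof.
move=> entryx.
apply: (@eval_prec 2 _ _
  (fun l => nat_of_bool (has (fun i => 0 < c i <= K) (iota 0 l)))) => // i il.
rewrite -(addn1 i) iotaD has_cat /= orbF orbC.
apply: (@eval_comp3 _ _ _ _ _ _ (c i) K (has _ (iota 0 i))) => //.
  apply: eval_comp3; [exact: erefl | exact: erefl | exact: eval_const |].
  exact: entryx.
exact: eval_range_or.
Qed.

Definition rdecide (Sg : signature) (s : sorts Sg) : recfun 1 :=
  let phi := @rproj 1 0 isT in
  let psi := rcode [:: rconst 1 4; rcomp1 (rdistinct s) rlast_entry; phi] in
  rcomp3 rhas_entry (rcomp1 len psi) psi rlast_entry.

(** Only evaluation is at stake here, so this also covers unsatisfiable [a], where the list and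
    hence [K] are arbitrary. *)
Lemma eval_decide (Sg : signature) (s : sorts Sg) (a : formula Sg) l c l' c' :
  let K := if l is k.+1 then c k else 0 in
  let x := formula_code a in
  let x' := formula_code (FOr (distinct s K) a) in
  rec_eval len [tuple x] l ->
  (forall i, i < l -> rec_eval entry [tuple x; i; p] (c i)) ->
  rec_eval len [tuple x'] l' ->
  (forall i, i < l' -> rec_eval entry [tuple x'; i; p] (c' i)) ->
  rec_eval (rdecide s) [tuple x]
    (has (fun i => 0 < c' i <= K) (iota 0 l')).
Proof.
move=> K x x' lenx entryx lenx' entryx'.
have evalK : rec_eval rlast_entry [tuple x] K by exact: eval_last_entry.
have evalx' : rec_eval
    (rcode [:: rconst 1 4; rcomp1 (rdistinct s) rlast_entry; @rproj 1 0 isT])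
    [tuple x] x'.
  do !apply: eval_code => //; first exact: eval_const.
  by apply: eval_comp1; [exact: evalK | exact: eval_distinct].
apply: eval_comp3; [|exact: evalx'|exact: evalK|exact: eval_has_entry].
by apply: eval_comp1; [exact: evalx' | exact: lenx'].
Qed.

End Decision.

(* [set_type (named_cardinal c)] and ['I_k] cannot play this role: their
   universes are too large for the values of a [cardfun S]. *)
Definition named_type (c : nat) : Set :=
  if c is k.+1 then {i : nat | i < k} else nat.

Lemma card_named_type c : [set: named_type c] #= named_cardinal c.
Proof.
case: c => [|k]; first exact: card_eqxx.
have injval : {in [set: {i : nat | i < k}] &, injective val}.
  by move=> i j _ _; exact: val_inj.
rewrite -(card_eql (inj_card_eq injval)).
suff -> : val @` [set: {i : nat | i < k}] = `I_k by exact: card_eqxx.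
by apply/seteqP; split=> [_ [[i ik] _ <-] //|i ik]; exists (exist _ i ik).
Qed.

(** Realize [n] in [A], shrink [A] to [B] finite on [S], and take [m] in [MM a] below [B]. Then [m]
    is pointwise at most [n], so the antichain condition forces [m] and [n] to agree, and [n] is
    bounded by [B]. *)
Lemma minimal_model_finite (Sg : signature) (T : theory Sg)
    (S : set (sorts Sg)) MM a (n : cardfun S) (s : S) :
  stably_finite T S -> minimal_model_function T MM ->
  qfree a -> satisfiable T a -> MM a n -> finite_set [set: n s].
Proof.
move=> sf mm qa sa MMn; have [real antichain below] := mm a qa sa.
have [A [TA Aa An]] := real n MMn.
have [B [TB Ba Bfin]] := sf a qa A TA Aa.
have [m MMm mB] := below B TB Ba.
have mn (t : S) : [set: m t] #<= [set: n t].
  rewrite -(card_le_eqr (An t)); apply: card_le_trans (mB t) _.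
  by case: (Bfin (val t) (set_valP t)).
have [E|] := pselect (cardfun_eq n m).
  rewrite (eq_finite_set (E s)); apply: card_le_finite (mB s) _.
  by case: (Bfin (val s) (set_valP s)).
by move=> /(antichain _ _ MMn MMm)[t [nm /[!card_eq_le] /negP]]; rewrite nm mn.
Qed.

Theorem theorem4 (Sg : signature) (T : theory Sg) (S : set (sorts Sg)) :
  nonempty S ->
  stably_infinite T S ->
  stably_finite T S ->
  (exists MM : formula Sg -> set (cardfun S),
     minimal_model_function T MM /\ computable_cardfuns MM) ->
  decidable_theory T.
Proof.
move=> [s0 Ss0] si sf [MM [mm [len [entry MMcomp]]]].
have [[A0 TA0]|incons] := pselect (exists A, interp_of T A); last first.
  exists (RZero 1) => a _; split=> // -[A TA _].
  by case: incons; exists A.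
pose s : S := SigSub (mem_set Ss0).
exists (rdecide len entry (pickle s0) s0) => a qa.
have [l [c [lenE entryE MME]]] := MMcomp a qa.
(* [K] is 0 if the list is empty or its last entry names aleph_0. Both occur only for unsatisfiable
   [a], and the test [0 < e <= 0] then rightly fails. *)
pose K := if l is k.+1 then c k s else 0.
pose b := FOr (distinct s0 K) a.
have qb : qfree b by rewrite /= qfree_distinct.
have [l' [c' [lenE' entryE' MME']]] := MMcomp b qb.
have ev := @eval_decide len entry (pickle s0) Sg s0 a l (c^~ s) l' (c'^~ s)
  lenE (fun i il => entryE i il s) lenE' (fun i il => entryE' i il s).
have sb : satisfiable T b.
  (* Stable infiniteness at a valid equation gives a model of [T] infinite at [s0]; reassigning its
     variables satisfies the left disjunct of [b]. *)
  have [||A [TA _ /(_ s0 Ss0)/infinite_sat_distinct[e edist]]] :=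
    si (eq_vars s0 0 0); [by [] | by exists A0 |].
  case: A TA e edist => M e0 TA e edist.
  by exists (Interpretation e); [exact: interp_of_assignment TA | left].
have [real' _ below'] := mm b qb sb.
have MM_entry (f : formula Sg) m (d : nat -> S -> nat) i :
    (forall n, MM f n <-> exists2 i, i < m &
       forall t : S, [set: n t] #= named_cardinal (d i t)) ->
    i < m -> MM f (fun t => named_type (d i t)).
  by move=> MMf im; apply/MMf; exists i => // t; exact: card_named_type.
split=> [sa|nsa].
- suff h : has (fun i => 0 < c' i s <= K) (iota 0 l') by rewrite /= h in ev.
  have [real _ below] := mm a qa sa.
  have [l0 lS] : exists l0, l = l0.+1.
    have [A TA Aa] := sa; have [n /MME[i il _] _] := below A TA Aa.
    by exists l.-1; rewrite (ltn_predK il).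
  have l0l : l0 < l by rewrite lS.
  have MMn := MM_entry _ _ _ _ MME l0l.
  have [k ck] : exists k, c l0 s = k.+1.
    have := minimal_model_finite s sf mm qa sa MMn.
    rewrite (eq_finite_set (card_named_type _)).
    by case: (c l0 s) => [/infinite_nat|k _] //; exists k.
  (* This model of [a] has [k] elements of sort [s0] and also satisfies [b], so some member of
     [MM b] is at most [k] there. *)
  have [A [TA Aa /(_ s)/card_eq_trans/(_ (card_named_type _)) Ak]] := real _ MMn.
  have [n /MME'[i il' /(_ s) ni] /(_ s)] := below' A TA (or_intror Aa).
  rewrite (card_le_eql ni) (card_le_eqr Ak) ck => ci_le.
  apply/hasP; exists i; first by rewrite mem_iota.
  (* The name 0 would put aleph_0 below the finite [k]; a name [j.+1] has [j <= k], that is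
     [j.+1 <= K]. *)
  rewrite /K lS ck; case: (c' i s) ci_le => [|j]; last by rewrite card_le_II.
  by move=> /card_le_finite/(_ (finite_II k))/infinite_nat.
suff h : has (fun i => 0 < c' i s <= K) (iota 0 l') = false.
  by rewrite /= h in ev.
apply/hasP => -[i]; rewrite mem_iota /= => il' /andP[c_gt0 c_leK].
(* An accepted entry would be realized by a model of [b] with fewer than [K] elements of sort [s0]:
   too few for the left disjunct, while the right one contradicts [nsa]. *)
have [A [TA Ab /(_ s)]] := real' _ (MM_entry _ _ _ _ MME' il').
move=> /card_eq_trans/(_ (card_named_type _)) As.
case: Ab => [/sat_distinct_card|Aa]; last by apply: nsa; exists A.
rewrite (card_le_eqr As) /named_cardinal; case: (c' i s) c_gt0 c_leK => // j _.
by rewrite card_le_II => /leq_trans h /h; rewrite ltnn.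
Qed.
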